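(* Let $K$ be a compact, linearly ordered space. Then the following are equivalent. (1) $K$ is fragmentable. (2) There is a family $L_n$, $n \in \mathbb{N}$, of compact, scattered subsets of $K$, with union $L = \bigcup_{n \in \mathbb{N}} L_n$, such that whenever $u,v \in K$ and $u < v$, there exist $x,y \in L$ satisfying $u \leq x < y \leq v$. (3) $K$ is Radon-Nikodým compact.
   Context: All topological spaces are Hausdorff. A linearly ordered space is a linearly ordered set equipped with its order topology. A topological space is scattered if every non-empty subset of it has a relatively isolated point. A compact space $K$ is fragmentable if there exists a metric $d : K \times K \to [0,\infty)$ (not assumed to be related to the topology of $K$) such that, given any non-empty set $M \subseteq K$ and $\varepsilon > 0$, there exists an open set $U \subseteq K$ with $M \cap U \neq \varnothing$ and $d$-diameter of $M \cap U$ less than $\varepsilon$. A compact space $K$ is Radon-Nikodým compact (RN compact) if there exists a metric $d$ on $K$ with this property which is in addition lower semicontinuous as a function on $K \times K$ (with the product of the given topology of $K$). *)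

(* Defs.v *)
From HB Require Import structures.
From mathcomp Require Import all_boot all_order all_algebra.
From mathcomp Require Import all_classical all_reals all_analysis.

Set Implicit Arguments.
Unset Strict Implicit.
Unset Printing Implicit Defensive.

Import Order.TTheory GRing.Theory Num.Theory.

Local Open Scope classical_set_scope.
Local Open Scope ring_scope.

(* [metricType] would equip the carrier with the topology of the metric; here
   the metric is a mere function, unrelated to the topology of the space. *)
Definition is_metric (R : realType) (T : Type) (d : T -> T -> R) : Prop :=
  [/\ forall x y, 0 <= d x y,
      forall x y, d x y = 0 <-> x = y,
      forall x y, d x y = d y x
    & forall x y z, d x z <= d x y + d y z].

(* The supremum is taken in [\bar R], so that an unbounded set has diameter
   [+oo]; the diameter of the empty set is [-oo]. *)
Definition diameter (R : realType) (T : Type) (d : T -> T -> R) (A : set T) :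
    \bar R :=
  ereal_sup [set (d x y)%:E | x in A & y in A].

Definition fragments (R : realType) (K : topologicalType) (d : K -> K -> R) :
    Prop :=
  forall (M : set K) (e : R), M !=set0 -> 0 < e ->
    exists U : set K,
      [/\ open U, M `&` U !=set0 & (diameter d (M `&` U) < e%:E)%E].

(* This notion and the next one are meant for compact Hausdorff spaces. *)
Definition fragmentable (R : realType) (K : topologicalType) : Prop :=
  exists d : K -> K -> R, is_metric d /\ fragments d.

Definition radon_nikodym (R : realType) (K : topologicalType) : Prop :=
  exists d : K -> K -> R,
    [/\ is_metric d, fragments d
      & lower_semicontinuous (fun p : K * K => (d p.1 p.2)%:E)].

(* [A] is scattered as a subspace of [T]: for [B] included in [A], the points
   isolated in [B] are the same whether [B] is seen as a subspace of [A] or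
   of [T]. *)
Definition scattered (T : topologicalType) (A : set T) : Prop :=
  forall B : set T, B `<=` A -> B !=set0 -> isolated B !=set0.

(* Main.v *)
Require Import Defs.
From HB Require Import structures.
From mathcomp Require Import all_boot all_order all_algebra.
From mathcomp Require Import all_classical all_reals all_analysis.
From mathcomp Require Import lra.

Set Implicit Arguments.
Unset Strict Implicit.
Unset Printing Implicit Defensive.

Import Order.TTheory GRing.Theory Num.Theory.
Import numFieldNormedType.Exports.

Local Open Scope classical_set_scope.
Local Open Scope ring_scope.

(** Only fragmentability => (2) => Radon-Nikodym needs an argument, since a
Radon-Nikodym space is fragmentable by definition.

From fragmentability to (2).  Fix [e > 0].  Removing from [K], again and
again, a relatively open piece of diameter less than [e] gives a decreasing
well-ordered family of closed sets; let [r C] be the last of them that still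
meets the closed set [C].  Then [C `&` r C], the part of [C] removed last, has
diameter less than [e], and smaller sets have larger [r] (they are exhausted
earlier).  This is [fragments_rank_function].  By minimality of rank every
interval [[a, b]] contains a compact scattered set [F] with ends [a] and [b]
such that each jump [u < v] of [F] (a gap, below) is either a jump of [K] or
has both ends in [r [u, v]] ([rank_tight_chain]).  Indeed, in a
counterexample of least rank let [x] and [y] be the extreme points of
[[a, b] `&` r [a, b]]; the pair [x, y] is tight, and intervals to the left of
[x] or to the right of [y] have smaller rank, so they can be cut, and a
Zorn argument strings such cuts together along a well-ordered sequence
converging to [x] or [y] ([scattered_chain_limit]).

Now let [L 0] consist of the end points of [K], and build [L n.+1] by filling
each gap of [L n] with such a set [F], for the rank function of [1 / (k n + 1)],
where [k] takes every value infinitely often.  Filling gaps preserves compact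
scattered sets.  If [u < v] were never separated, a decreasing sequence of gaps
[[x n, y n]] would surround a nondegenerate interval.  Each rank of these gaps
is eventually constant, because the ranks are well-ordered; so infinitely many
[x n] and [y n] lie in one closed set, which then contains [sup x] and [inf y].
Hence these two limits are at distance less than every [1 / (i + 1)], so they
coincide: contradiction ([nested_gaps_collapse]).

From (2) to Radon-Nikodym.  Make the [L n] increasing, and call [A n] the
result.  For each gap [a < b] choose a continuous [f a b] with values in
[[0, 1]], equal to 0 below [a] and to 1 above [b], and let [dist u v] be the
supremum of [|f a b u - f a b v| / (n + 1)] over all [n] and all gaps of
[A n].  A supremum of continuous functions is lower semicontinuous; a compact
scattered set has a gap between any two of its points, so [dist] separates
points; and for one [n] the functions fragment, since inside a gap only one of
them varies, while a set that avoids the open gaps lies in the scattered set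
[A n] and has an isolated point. *)

(** * Towers of sets *)

(** The transfinite iteration of [next] from the full set, without ordinals:
the empty intersection is the starting point, and intersections are the limit
stages. *)
Inductive tower (T : Type) (next : set T -> set T) : set T -> Prop :=
| tower_next C : tower next C -> tower next (next C)
| tower_bigcap (S : set (set T)) :
    (forall C, S C -> tower next C) -> tower next (\bigcap_(C in S) C).

(** The auxiliary notion in Zermelo's proof that such an iteration is
totally ordered: [next] never steps over [D]. *)
Definition extreme (T : Type) (next : set T -> set T) (D : set T) : Prop :=
  forall C, tower next C -> D `<=` C -> C <> D -> D `<=` next C.

Lemma extreme_cut (T : Type) (next : set T -> set T) (D : set T) :
  (forall C, next C `<=` C) -> extreme next D ->
  forall C, tower next C -> D `<=` C \/ C `<=` next D.
Proof.
move=> nextS Dext C; elim=> {C} [C Ct [DC|CD]|S St IH].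
- have [->|CnD] := pselect (C = D); first by right.
  by left; apply: Dext.
- by right; apply: subset_trans (nextS C) CD.
- have [[C [SC CD]]|noC] := pselect (exists C, S C /\ C `<=` next D).
    by right=> z /(_ C SC) /CD.
  left=> z Dz C SC; case: (IH C SC) => [|CD]; first exact.
  by exfalso; apply: noC; exists C.
Qed.

Lemma tower_extreme (T : Type) (next : set T -> set T) (D : set T) :
  (forall C, next C `<=` C) -> tower next D -> extreme next D.
Proof.
move=> nextS; elim=> {D} [D Dt Dext C Ct DC CnD|S St IH C Ct SC CnS].
- have [DC'|CD] := extreme_cut nextS Dext Ct; last first.
    by exfalso; apply: CnD; apply/seteqP.
  have [->//|CnD'] := pselect (C = D).
  exact: subset_trans (nextS D) (Dext _ Ct DC' CnD').
- have [allC|] := pselect (forall D, S D -> C `<=` D).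
    exfalso; apply: CnS; apply/seteqP; split=> // z Cz D SD.
    exact: allC Cz.
  move=> /existsNP[D /not_implyP[SD CnD]].
  have [DC|CD] := extreme_cut nextS (IH D SD) Ct; last first.
    by exfalso; apply: CnD; apply: subset_trans CD (nextS D).
  have CD : C <> D by move=> CD; apply: CnD; rewrite CD.
  by move=> z /(_ D SD); apply: IH SD _ Ct DC CD z.
Qed.

Lemma tower_total (T : Type) (next : set T -> set T) :
  (forall C, next C `<=` C) -> total_on (tower next) subset.
Proof.
move=> nextS C D Ct Dt.
have Dext := tower_extreme nextS Dt.
have [DC|CD] := extreme_cut nextS Dext Ct; first by right.
by left; apply: subset_trans CD (nextS D).
Qed.

(** Well-ordering, for reverse inclusion, of the nonempty stages: the least
stage [E] above the whole family belongs to it, since otherwise [next E] would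
still be above the family. *)
Lemma tower_largest (T : Type) (next : set T -> set T) (S : set (set T)) :
  (forall C, next C `<=` C) -> (forall C, C !=set0 -> next C <> C) ->
  S `<=` tower next -> S !=set0 -> (forall C, S C -> C !=set0) ->
  exists2 C, S C & forall D, S D -> D `<=` C.
Proof.
move=> nextS next_neq St [C0 SC0] S0.
pose E := \bigcap_(D in [set D | tower next D /\ forall C, S C -> C `<=` D]) D.
have Et : tower next E by apply: tower_bigcap => D [].
have SE C : S C -> C `<=` E by move=> SC z Cz D [_ /(_ C SC) CD]; exact: CD.
exists E; last exact: SE.
apply: contrapT => nSE.
have nextE : E `<=` next E.
  move=> z; apply; split; first exact: tower_next.
  move=> C SC; apply: (tower_extreme nextS (St _ SC)) => //.
    exact: SE.
  by move=> EC; apply: nSE; rewrite EC.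
apply: (next_neq E); last by apply/seteqP; split.
by have [z Cz] := S0 _ SC0; exists z; apply: SE Cz.
Qed.

(** * Rank functions *)

Lemma compact_chain (T : topologicalType) (A : set T) (D : set (set T)) :
  compact A -> D !=set0 -> (forall C, D C -> closed C /\ A `&` C !=set0) ->
  total_on D subset -> A `&` \bigcap_(C in D) C !=set0.
Proof.
move=> cA [C0 DC0] Dcl Dtot.
pose F := filter_from D (fun C => A `&` C).
have FF : ProperFilter F.
  apply: filter_from_proper; last by move=> C /Dcl[].
  apply: filter_from_filter; first by exists C0.
  move=> C C' DC DC'; have [CC'|CC'] := Dtot _ _ DC DC'.
    by exists C => // z [Az Cz]; do 2 split=> //; apply: CC'.
  by exists C' => // z [Az Cz]; do 2 split=> //; apply: CC'.
have [|p [Ap Fp]] := cA F FF; first by exists C0 => // z [].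
exists p; split=> // C DC; have [clC _] := Dcl _ DC.
apply: clC => U pU; have [|z [Cz Uz]] := Fp C U _ pU; last by exists z.
by exists C => // z [].
Qed.

(** [r C] stands for the ordinal rank of [C], namely for the last stage of a
removal process that meets [C]; a larger [r C] is a smaller rank.  The second
clause says that a set meeting the top part of [C] has at least the rank of
[C]; the third that every family of nonempty closed sets has one of least
rank. *)
Definition rank_function (T : topologicalType) (R : realType)
    (d : T -> T -> R) (e : R) (r : set T -> set T) : Prop :=
  [/\ forall C, closed C -> C !=set0 ->
        [/\ closed (r C), C `&` r C !=set0 &
            forall x y, (C `&` r C) x -> (C `&` r C) y -> d x y < e],
      forall C C', C' `&` r C !=set0 -> r C' `<=` r C &
      forall S : set (set T), S !=set0 ->
        (forall C, S C -> closed C /\ C !=set0) ->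
        exists2 C, S C & forall C', S C' -> r C' `<=` r C].

(** The tower is that of [next C = C `\` U], with [U] open, meeting [C], and
[C `&` U] of diameter less than [e].  As [C] meets [r C] but not [next (r C)],
the set [C `&` r C] lies in the piece removed from [r C]. *)
Lemma fragments_rank_function (T : topologicalType) (R : realType)
    (d : T -> T -> R) (e : R) :
  compact [set: T] -> fragments d -> 0 < e -> exists r, rank_function d e r.
Proof.
move=> cT frd e0.
have /choice[U HU] : forall C : set T, exists U : set T, C !=set0 ->
    [/\ open U, C `&` U !=set0 &
        forall x y, (C `&` U) x -> (C `&` U) y -> d x y < e].
  move=> C; have [C0|C0] := pselect (C !=set0); last by exists set0.
  have [U [oU CU dU]] := frd C e C0 e0; exists U => _; split=> // x y Cx Cy.
  rewrite -lte_fin; apply: le_lt_trans dU; apply: ereal_sup_ubound.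
  by exists x => //; exists y.
pose next (C : set T) := [set z | C z /\ ~ (C !=set0 /\ U C z)].
have nextS C : next C `<=` C by move=> z [].
have next_neq C : C !=set0 -> next C <> C.
  move=> C0; have [_ [z [Cz Uz]] _] := HU C C0.
  by move=> nextC; move: (Cz); rewrite -nextC => -[_]; apply.
have tcl C : tower next C -> closed C.
  elim=> {C} [C _ clC|S _]; last exact: closed_bigI.
  have [C0|C0] := pselect (C !=set0); last first.
    by have -> : next C = C
      by apply/seteqP; split=> z; [case|move=> Cz; split=> // -[]].
  have -> : next C = C `&` ~` U C.
    by apply/seteqP; split=> z [Cz Uz]; split=> //; [move=> ?; apply: Uz|case].
  by apply: closedI => //; apply: open_closedC; case: (HU C C0).
pose r (C : set T) := \bigcap_(E in [set E | tower next E /\ C `&` E !=set0]) E.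
have rt C : tower next (r C) by apply: tower_bigcap => E [].
have rsub C C' : C' `&` r C !=set0 -> r C' `<=` r C.
  by move=> C'r z; apply; split.
have rmeet C : closed C -> C !=set0 -> C `&` r C !=set0.
  move=> clC C0; apply: compact_chain.
  - exact: subclosed_compact clC cT _.
  - exists [set: T]; split; last by rewrite setIT.
    rewrite -(bigcap_set0 (fun C : set T => C)).
    by apply: tower_bigcap.
  - by move=> E [/tcl].
  - by move=> E E' [Et _] [E't _]; apply: (tower_total nextS).
exists r; split=> //.
- move=> C clC C0; have Cr := rmeet C clC C0; split=> //; first exact: tcl.
  have rU z : (C `&` r C) z -> U (r C) z.
    move=> [Cz rz]; apply: contrapT => nUz.
    have Cn : C `&` next (r C) !=set0 by exists z; split=> //; split=> // -[].
    have /(_ Cn) : C `&` next (r C) !=set0 -> r C `<=` next (r C).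
      by move=> Cn' w; apply; split=> //; apply: tower_next.
    move=> rn; have := next_neq (r C); apply; last by apply/seteqP; split.
    by exists z.
  have [_ _ dU] := HU (r C) (ex_intro _ _ (proj2 (projT2 (cid Cr)))).
  by move=> x y Cx Cy; apply: dU; split; try exact: rU;
     [case: Cx|case: Cy].
- move=> S [C0 SC0] Scl.
  have [|||_ [C SC <-] rmax] :=
      @tower_largest _ next [set r C | C in S] nextS next_neq.
  + by move=> _ [C _ <-].
  + by exists (r C0); exists C0.
  + move=> _ [C SC <-]; have [clC Cn0] := Scl _ SC.
    by have [z [_ rz]] := rmeet C clC Cn0; exists z.
  + by exists C => // C' SC'; apply: rmax; exists C'.
Qed.

(** * Closed orders and scattered sets *)

(** Stated for a relation so that each one-sided argument serves for an order
and for its reverse. *)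
Definition closed_order (T : topologicalType) (le : rel T) : Prop :=
  [/\ total le, transitive le, antisymmetric le
    & forall t, closed [set z | le t z] /\ closed [set z | le z t]].

Lemma closed_order_flip (T : topologicalType) (le : rel T) :
  closed_order le -> closed_order (fun x y => le y x).
Proof.
move=> [tot tr anti cl]; split.
- by move=> x y; apply: tot.
- by move=> y x z xy yz; apply: tr yz xy.
- by move=> x y; rewrite andbC; apply: anti.
- by move=> t; have [? ?] := cl t.
Qed.

Lemma closed_order_le d (K : orderTopologicalType d) :
  closed_order (fun x y : K => (x <= y)%O).
Proof.
split.
- exact: le_total.
- exact: le_trans.
- exact: le_anti.
- move=> t; split.
    by have := @rray_closed _ K t; rewrite set_itvE.
  by have := @lray_closed _ K t; rewrite set_itvE.
Qed.

Lemma closed_order_refl (T : topologicalType) (le : rel T) x :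
  closed_order le -> le x x.
Proof. by case=> tot _ _ _; have := tot x x; rewrite orbb. Qed.

Lemma closed_order_nle (T : topologicalType) (le : rel T) x y :
  closed_order le -> ~~ le x y -> le y x.
Proof. by case=> tot _ _ _; have := tot x y; case: (le x y). Qed.

Lemma compact_has_max (T : topologicalType) (le : rel T) (C : set T) :
  closed_order le -> compact C -> C !=set0 ->
  exists2 m, C m & forall z, C z -> le z m.
Proof.
move=> ole cC [c0 Cc0]; have [tot tr anti cl] := ole.
have [|||m [Cm Dm]] := @compact_chain T C [set [set z | le c z] | c in C] cC.
- by exists [set z | le c0 z]; exists c0.
- move=> _ [c Cc <-]; split; first by case: (cl c).
  by exists c; split=> //; apply: closed_order_refl.
- move=> _ _ [c _ <-] [c' _ <-]; have /orP[cc'|c'c] := tot c c'; [right|left].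
    by move=> z; apply: tr.
  by move=> z; apply: tr.
exists m => // z Cz; exact: (Dm [set w | le z w] (ex_intro2 _ _ z Cz erefl)).
Qed.

Lemma compact_has_lub (T : topologicalType) (le : rel T) (A : set T) :
  closed_order le -> compact [set: T] -> A !=set0 ->
  exists2 s, (forall z, A z -> le z s) &
             (forall u, (forall z, A z -> le z u) -> le s u).
Proof.
move=> ole cT [a Aa]; have [tot tr anti cl] := ole.
have cA : compact (closure A).
  by apply: subclosed_compact cT _ => //; apply: closed_closure.
have [|s As smax] := compact_has_max ole cA.
  by exists a; apply: subset_closure.
exists s; first by move=> z Az; apply: smax; apply: subset_closure.
move=> u uA; have [_ clu] := cl u.
exact: clu _ (closureS uA As).
Qed.

Lemma isolated_open (T : topologicalType) (B V : set T) x :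
  open V -> isolated (B `&` V) x -> isolated B x.
Proof.
move=> oV [/set_mem[Bx Vx] [W xW WB]]; split; first exact/mem_set.
exists (W `&` V); first by apply: filterI => //; apply: open_nbhs_nbhs.
by rewrite -setIA (setIC V).
Qed.

(** Scatteredness may be checked locally outside a scattered set: a subset not
contained in [C] has an isolated point near any of its points outside [C]. *)
Lemma scattered_locally (T : topologicalType) (A C : set T) :
  scattered C ->
  (forall x, A x -> ~ C x -> exists2 V, open V /\ V x & scattered (A `&` V)) ->
  scattered A.
Proof.
move=> sC loc B BA [b Bb].
have [BC|] := pselect (B `<=` C); first by apply: sC => //; exists b.
move=> /existsNP[x /not_implyP[Bx nCx]].
have [V [oV Vx] sV] := loc x (BA _ Bx) nCx.
have [||y yi] := sV (B `&` V); last by exists y; apply: isolated_open yi.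
  by move=> z [/BA].
by exists x.
Qed.

Lemma scatteredS (T : topologicalType) (A B : set T) :
  A `<=` B -> scattered B -> scattered A.
Proof. by move=> AB sB C CA; apply: sB; apply: subset_trans AB. Qed.

Lemma scattered_set1 (T : topologicalType) (x : T) : scattered [set x].
Proof.
move=> B Bx [y By]; exists y; split; first exact/mem_set.
exists setT; first exact: filterT.
rewrite setTI; apply/seteqP; split=> z; last by move=> ->.
by move=> /Bx ->; rewrite (Bx _ By).
Qed.

Lemma scatteredU (T : topologicalType) (A B : set T) :
  closed B -> scattered A -> scattered B -> scattered (A `|` B).
Proof.
move=> clB sA sB; apply: (@scattered_locally _ _ B) => // x _ nBx.
exists (~` B); first by split=> //; apply: closed_openC.
by apply: scatteredS sA => z [[]].
Qed.

(** * Scattered chains between two points *)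

Definition gap (T : Type) (le : rel T) (A : set T) u v : Prop :=
  [/\ A u, A v, ~~ le v u & forall z, A z -> le z u \/ le v z].

(** Containing both ends makes chains over adjacent intervals compose: no gap of
the union crosses the common end. *)
Definition scattered_chain (T : topologicalType) (le : rel T)
    (P : T -> T -> Prop) a b (F : set T) : Prop :=
  [/\ closed F, scattered F, F a /\ F b,
      forall z, F z -> le a z /\ le z b & forall u v, gap le F u v -> P u v].

Lemma scattered_chain_flip (T : topologicalType) (le : rel T) P a b F :
  scattered_chain le P a b F ->
  scattered_chain (fun x y => le y x) (fun x y => P y x) b a F.
Proof.
move=> [clF sF [Fa Fb] Fab FP]; split=> //; first by move=> z /Fab[].
move=> u v [Fu Fv uv Fuv]; apply: FP; split=> // z /Fuv[]; tauto.
Qed.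

Lemma scattered_chain_cat (T : topologicalType) (le : rel T) P a b c F G :
  closed_order le -> scattered_chain le P a b F -> scattered_chain le P b c G ->
  scattered_chain le P a c (F `|` G).
Proof.
move=> ole [clF sF [Fa Fb] Fab FP] [clG sG [Gb Gc] Gbc GP].
have [tot tr anti cl] := ole; split.
- exact: closedU.
- exact: scatteredU.
- by split; [left|right].
- have ab : le a b by case: (Fab b Fb).
  have bc : le b c by case: (Gbc c Gc).
  move=> z [/Fab[az zb]|/Gbc[bz zc]]; split=> //.
    exact: tr zb bc.
  exact: tr ab bz.
- move=> u v [FGu FGv vu FGuv].
  have [Fu|nFu] := pselect (F u).
    have [Fv|nFv] := pselect (F v).
      by apply: FP; split=> // z Fz; apply: FGuv; left.
    have bv : le b v by case: FGv => // /Gbc[].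
    have [bu|vb] := FGuv b (or_introl Fb); last first.
      by exfalso; apply: nFv; rewrite (anti v b) // vb bv.
    have ub : u = b by apply: anti; case: (Fab u Fu) => _ ->.
    rewrite ub; apply: GP; rewrite -ub; split=> //; first by rewrite ub.
      by case: FGv.
    by move=> z Gz; apply: FGuv; right.
  have Gu : G u by case: FGu.
  have bu : le b u by case: (Gbc u Gu).
  have Gv : G v.
    case: FGv => // Fv; exfalso; move/negP: vu; apply.
    by apply: tr bu; case: (Fab v Fv).
  by apply: GP; split=> // z Gz; apply: FGuv; right.
Qed.

Lemma scattered_chain1 (T : topologicalType) (le : rel T) P a :
  closed_order le -> closed [set a] -> scattered_chain le P a a [set a].
Proof.
move=> ole cla; have aa := closed_order_refl a ole; split=> //.
- exact: scattered_set1.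
- by move=> z ->.
- by move=> u v [-> ->]; rewrite aa.
Qed.

Lemma scattered_chain2 (T : topologicalType) (le : rel T)
    (P : T -> T -> Prop) a b :
  closed_order le -> closed [set a] -> closed [set b] -> le a b ->
  (~~ le b a -> P a b) -> scattered_chain le P a b ([set a] `|` [set b]).
Proof.
move=> ole cla clb ab Pab.
have aa := closed_order_refl a ole; have bb := closed_order_refl b ole.
split.
- exact: closedU.
- by apply: scatteredU => //; apply: scattered_set1.
- by split; [left|right].
- by move=> z [] ->.
- by move=> u v [[->|->] [->|->]]; rewrite ?aa ?bb ?ab // => /Pab.
Qed.

(** Zorn's lemma gives a maximal chain from [a], for end extension; it must
end at [x], because otherwise one more step extends it.  The union of a family
of chains, completed by the supremum of their ends, is closed and scattered
since below that supremum it agrees locally with one of them. *)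
Lemma scattered_chain_limit (T : topologicalType) (le : rel T)
    (P : T -> T -> Prop) a x :
  closed_order le -> compact [set: T] -> (forall z : T, closed [set z]) ->
  (forall u v, ~~ le v u -> (forall z, le z u \/ le v z) -> P u v) ->
  le a x ->
  (forall t t', le a t -> le t t' -> ~~ le x t' ->
     exists F, scattered_chain le P t t' F) ->
  exists F, scattered_chain le P a x F.
Proof.
move=> ole cT cl1 Pjump ax step; have [tot tr anti cl] := ole.
have lexx z := closed_order_refl z ole.
pose X := {p : set T * T | scattered_chain le P a p.2 p.1 /\ le p.2 x}.
pose ext (p q : X) := `[< le (sval p).2 (sval q).2 /\
   forall z, (sval p).1 z <-> (sval q).1 z /\ le z (sval p).2 >].
have p0 : X by exists ([set a], a); split=> //; apply: scattered_chain1.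
have [|p q s /asboolP[pq Fpq] /asboolP[qs Fqs]|A Atot|p pmax] :=
  @ZL_preorder X p0 ext.
- move=> [[F t] /= [Ft tx]]; apply/asboolP; split=> //= z; split=> [Fz|[]//].
  by split=> //; case: Ft => _ _ _ /(_ z Fz)[].
- apply/asboolP; split; first exact: tr pq qs.
  move=> z; split=> [/Fpq[/Fqs[sz _] zp]//|[sz zp]].
  by apply/Fpq; split=> //; apply/Fqs; split=> //; apply: tr zp pq.
- have [[p1 Ap1]|A0] := pselect (exists p, A p); last first.
    by exists p0 => p Ap; exfalso; apply: A0; exists p.
  have [|s sub sleast] :=
    @compact_has_lub T le [set (sval p).2 | p in A] ole cT.
    by exists (sval p1).2; exists p1.
  have {}sub p : A p -> le (sval p).2 s by move=> Ap; apply: sub; exists p.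
  have below z : ~~ le s z -> exists2 p, A p & ~~ le (sval p).2 z.
    move=> nsz; apply: contrapT => no; move/negP: nsz; apply; apply: sleast.
    by move=> _ [p Ap <-]; apply/negPn/negP => npz; apply: no; exists p.
  pose G := (\bigcup_(p in A) (sval p).1) `|` [set s].
  have GE p z : A p -> (sval p).1 z <-> G z /\ le z (sval p).2.
    move=> Ap; have [[_ _ [_ Fpt] Fpb _] _] := svalP p; split.
      by move=> pz; split; [left; exists p|case: (Fpb z pz)].
    move=> [[[q Aq qz]|->] zp]; last first.
      by rewrite (anti s (sval p).2) // zp sub.
    have [/asboolP[pq Fpq]|/asboolP[qp Fqp]] := Atot _ _ Ap Aq.
      exact/Fpq.
    by have /Fqp[] := qz.
  have Gs z : G z -> le z s.
    move=> [[p Ap pz]|->//]; apply: tr (sub p Ap).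
    by have /(GE _ _ Ap)[] := pz.
  (* Below [s], the set [G] agrees near each point with one chain of [A]. *)
  have Gloc z : ~~ le s z -> exists2 p, A p & exists2 V, open V /\ V z
      & G `&` V `<=` (sval p).1.
    move=> /below[p Ap npz]; exists p => //.
    exists (~` [set w | le (sval p).2 w]).
      split; first by apply: closed_openC; case: (cl (sval p).2).
      exact/negP.
    by move=> w [Gw /negP wp]; apply/GE => //; split=> //;
      apply: closed_order_nle ole wp.
  have sx : le s x by apply: sleast => _ [p _ <-]; have [] := svalP p.
  have Gchain : scattered_chain le P a s G.
    split.
    - move=> z clGz; have [->|zs] := pselect (z = s); first by right.
      have [sz|nsz] := boolP (le s z).
        exfalso; apply: zs; apply: anti; rewrite sz andbT.
        have [_ cls] := cl s; exact: cls _ (closureS Gs clGz).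
      have [p Ap [V [oV Vz] GV]] := Gloc z nsz.
      left; exists p => //; have [[clF _ _ _ _] _] := svalP p.
      apply: clF => W zW; have [|w [Gw [Ww Vw]]] := clGz (W `&` V).
        by apply: filterI => //; apply: open_nbhs_nbhs.
      by exists w; split=> //; apply: GV.
    - apply: (@scattered_locally _ _ [set s]); first exact: scattered_set1.
      move=> z Gz zs; have [|p Ap [V oV GV]] := Gloc z.
        by apply/negP => sz; apply: zs; apply: anti; rewrite sz Gs.
      exists V => //; apply: scatteredS GV _.
      by have [[]] := svalP p.
    - split; last by right.
      left; exists p1 => //.
      by have [[_ _ [] ]] := svalP p1.
    - move=> z Gz; split; last exact: Gs.
      case: Gz => [[p Ap pz]|->].
        by have [[_ _ _ /(_ z pz)[]]] := svalP p.
      apply: tr (sub p1 Ap1).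
      by have [[_ _ [_ Ft] /(_ _ Ft)[]]] := svalP p1.
    - move=> u v [Gu Gv vu Guv].
      have [p Ap pv] : exists2 p, A p & (sval p).1 v.
        case: (Gv) => [[p Ap pv]|vs]; first by exists p.
        have [|p Ap pu] := below u; first by rewrite -vs.
        exists p => //; have [[_ _ [_ pt] _ _] _] := svalP p.
        have /(GE _ _ Ap)[Gt _] := pt.
        have [tu|] := Guv _ Gt; first by rewrite tu in pu.
        by move=> vt; rewrite vs in vt *; rewrite (anti s (sval p).2) // vt sub.
      have [[_ _ _ _ FP] _] := svalP p.
      have /(GE _ _ Ap)[_ vp] := pv.
      apply: FP; split=> //.
        apply/GE => //; split=> //; apply: tr vp.
        exact: closed_order_nle ole vu.
      by move=> z /(GE _ _ Ap)[Gz _]; apply: Guv.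
  exists (exist _ (G, s) (conj Gchain sx)) => p Ap; apply/asboolP; split=> /=.
    exact: sub.
  by move=> z; apply: GE.
- case: p pmax => -[F t] [/= Ft tx] pmax.
  have [xt|nxt] := boolP (le x t).
    by exists F; rewrite (anti x t) // xt tx.
  exfalso.
  have at_ : le a t by have [_ _ [_ Ftt] /(_ t Ftt)[]] := Ft.
  have [t' [ntt' t'x [G Gt]]] : exists t', [/\ ~~ le t' t, le t' x
      & exists G, scattered_chain le P t t' G].
    (* If no point lies strictly between [t] and [x], then the pair itself is
       a step, as jumps satisfy [P]. *)
    have [[t' [ntt' nxt']]|no] := pselect (exists t', ~~ le t' t /\ ~~ le x t').
      exists t'; split=> //; first exact: closed_order_nle ole nxt'.
      by apply: step => //; apply: closed_order_nle ole ntt'.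
    exists x; split=> //; exists ([set t] `|` [set x]).
    apply: scattered_chain2 => //.
    move=> _; apply: Pjump => // z.
    have [zt|nzt] := boolP (le z t); first by left.
    have [xz|nxz] := boolP (le x z); first by right.
    by exfalso; apply: no; exists z.
  have FG := scattered_chain_cat ole Ft Gt.
  have tt' := closed_order_nle ole ntt'.
  have [_ _ [_ Ftt] Fb _] := Ft.
  have [_ _ _ Gb _] := Gt.
  have : ext (exist _ (F `|` G, t') (conj FG t'x))
             (exist _ (F, t) (conj Ft tx)).
    apply: pmax; apply/asboolP; split=> //= z; split=> [Fz|[[//|Gz] zt]].
      by split; [left|case: (Fb z Fz)].
    by rewrite (anti z t) // zt; case: (Gb z Gz).
  by move=> /asboolP[/= t't]; rewrite t't in ntt'.
Qed.

Lemma closed_sup (T : topologicalType) (le : rel T) (A C : set T) s :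
  closed_order le -> compact [set: T] -> closed C -> A !=set0 ->
  (forall z, A z -> le z s) ->
  (forall u, (forall z, A z -> le z u) -> le s u) ->
  (forall z, A z -> exists c, [/\ A c, C c & le z c]) -> C s.
Proof.
move=> ole cT clC [a Aa] sub sleast cof; have [tot tr anti cl] := ole.
have [c [Ac Cc _]] := cof a Aa.
have [||m [Cm ms] mmax] := @compact_has_max T le (C `&` [set z | le z s]) ole.
- apply: subclosed_compact cT _ => //; apply: closedI => //.
  by case: (cl s).
- by exists c; split=> //; apply: sub.
suff -> : s = m by [].
apply: anti; rewrite ms andbT; apply: sleast => z Az.
have [c' [Ac' Cc' zc']] := cof z Az.
by apply: tr zc' (mmax _ _); split=> //; apply: sub.
Qed.

Lemma order_closed_set1 d (K : orderTopologicalType d) (z : K) : closed [set z].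
Proof.
by apply: accessible_closed_set1; apply: hausdorff_accessible;
   exact: order_hausdorff.
Qed.

Lemma closed_between d (K : orderTopologicalType d) (a b : K) :
  closed [set z | (a <= z <= b)%O].
Proof. by have := @itv_closed _ K a b; rewrite set_itvE. Qed.

Lemma open_between d (K : orderTopologicalType d) (a b : K) :
  open [set z | (a < z < b)%O].
Proof. by have := @itv_open _ K a b; rewrite set_itvE. Qed.

(** * Cutting an interval into tight gaps *)

(** A jump of [K] is accepted whatever its rank: no chain can refine it. *)
Definition rank_tight d (K : orderTopologicalType d) (r : set K -> set K)
    (u v : K) : Prop :=
  (r [set z | (u <= z <= v)%O] u /\ r [set z | (u <= z <= v)%O] v) \/
  (forall z, (z <= u)%O \/ (v <= z)%O).

(** Among the intervals without such a chain take [I = [a, b]] of least rank.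
An interval missing [r I] has smaller rank, hence has a chain; so [a] can be
joined to the first point [x] of [I `&` r I], and its last point [y] to [b],
while [x] and [y] form a tight pair. *)
Lemma rank_tight_chain d (K : orderTopologicalType d) (R : realType)
    (dist : K -> K -> R) (e : R) (r : set K -> set K) (a b : K) :
  compact [set: K] -> rank_function dist e r -> (a <= b)%O ->
  exists F, scattered_chain <=%O (rank_tight r) a b F.
Proof.
move=> cK [rP rsub rwf] ab.
have ole := closed_order_le K.
have cl1 := @order_closed_set1 _ K.
apply: contrapT => nab.
pose S := [set C : set K | exists a b : K, [/\ (a <= b)%O,
  ~ (exists F, scattered_chain <=%O (rank_tight r) a b F)
  & C = [set z | (a <= z <= b)%O]]].
have [||_ [{nab ab} {}a [{}b [ab nab ->]]] rmax] := rwf S.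
- by exists [set z | (a <= z <= b)%O]; exists a; exists b.
- move=> _ [a' [b' [a'b' _ ->]]]; split; first exact: closed_between.
  by exists a'; rewrite /= lexx a'b'.
apply: nab; set I := [set z | (a <= z <= b)%O] in rmax.
have clI : closed I by apply: closed_between.
have I0 : I !=set0 by exists a; rewrite /I /= lexx.
have [clr Ir _] := rP I clI I0.
have lower s t : (s <= t)%O -> (forall z, (s <= z <= t)%O -> ~ r I z) ->
    exists F, scattered_chain <=%O (rank_tight r) s t F.
  move=> st nr; apply: contrapT => nst.
  have rst : r [set z | (s <= z <= t)%O] `<=` r I.
    by apply: rmax; exists s; exists t.
  have [_ [z [zst rz]] _] := rP _ (@closed_between _ K s t)
    (ex_intro _ s (introT andP (conj (lexx s) st))).
  by apply: nr zst _; apply: rst.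
have cIr : compact (I `&` r I).
  by apply: subclosed_compact cK _ => //; apply: closedI.
have [y [Iy ry] ymax] := compact_has_max ole cIr Ir.
have [x [Ix rx] xmin] := compact_has_max (closed_order_flip ole) cIr Ir.
have /andP[ax xb] := Ix; have /andP[ay yb] := Iy.
have xy : (x <= y)%O by apply: ymax.
have jump (u v : K) : ~~ (v <= u)%O -> (forall z, (z <= u)%O \/ (v <= z)%O) ->
    rank_tight r u v by move=> _; right.
have [F Fax] : exists F, scattered_chain <=%O (rank_tight r) a x F.
  apply: scattered_chain_limit => // t t' at_ tt' nxt'.
  apply: lower => // z /andP[tz zt'] rz; apply: (negP nxt').
  apply: (le_trans _ zt'); apply: xmin; split=> //; rewrite /I /=.
  rewrite (le_trans at_ tz) /=; apply: (le_trans zt' (le_trans _ xb)).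
  exact: closed_order_nle ole nxt'.
have [G Gyb] : exists G, scattered_chain <=%O (rank_tight r) y b G.
  have [||t t' bt tt' nyt'|G Gby] :=
    @scattered_chain_limit K (fun x y => (y <= x)%O)
    (fun x y => rank_tight r y x) b y (closed_order_flip ole) cK cl1.
  - by move=> u v _ uv; right=> z; case: (uv z); tauto.
  - exact: yb.
  - have [z /andP[t'z zt] rz|H Ht] := lower t' t tt'.
      apply: (negP nyt').
      apply: (le_trans t'z); apply: ymax; split=> //; rewrite /I /=.
      rewrite (le_trans zt bt) andbT; apply: (le_trans ay (le_trans _ t'z)).
      exact: closed_order_nle (closed_order_flip ole) nyt'.
    by exists H; apply: scattered_chain_flip Ht.
  by exists G; apply: scattered_chain_flip Gby.
have Hxy : scattered_chain <=%O (rank_tight r) x y ([set x] `|` [set y]).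
  apply: scattered_chain2 => // _; left.
  have rI : r I `<=` r [set z | (x <= z <= y)%O].
    apply: rsub.
    have [_ [z [zxy rz]] _] := rP _ (@closed_between _ K x y)
      (ex_intro _ x (introT andP (conj (lexx x) xy))).
    exists z; split=> //; move/andP: zxy => [xz zy].
    by rewrite /I /= (le_trans ax xz) (le_trans zy yb).
  by split; apply: rI.
exists (F `|` ([set x] `|` [set y]) `|` G).
exact: scattered_chain_cat ole (scattered_chain_cat ole Fax Hxy) Gyb.
Qed.

(** * Filling the gaps of a scattered set *)

Lemma gap_around d (K : orderTopologicalType d) (A : set K) (u v a b : K) :
  compact A -> A a -> A b -> (a <= u)%O -> (u <= v)%O -> (v <= b)%O ->
  (A u -> (u < v)%O) ->
  (forall z, A z -> (z <= u)%O \/ (v <= z)%O) ->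
  exists x y, [/\ gap <=%O A x y, (x <= u)%O & (v <= y)%O].
Proof.
move=> cA Aa Ab au uv vb uNv Auv; have ole := closed_order_le K.
have [_ _ _ cl] := ole; have [_ _ _ cl'] := closed_order_flip ole.
have [||x [Ax xu] xmax] :=
  @compact_has_max K <=%O (A `&` [set z | (z <= u)%O]) ole.
- by apply: compact_closedI => //; case: (cl u).
- by exists a.
have [||y [Ay vy] ymin] := @compact_has_max K (fun x y => (y <= x)%O)
    (A `&` [set z | (v <= z)%O]) (closed_order_flip ole).
- by apply: compact_closedI => //; case: (cl v).
- by exists b.
exists x, y; split=> //; split=> //.
  rewrite -ltNge lt_neqAle (le_trans xu (le_trans uv vy)) andbT.
  apply/eqP => xy; have uxE : u = x.
    by apply/le_anti; rewrite xu andbT xy (le_trans uv vy).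
  by have := lt_le_trans (uNv (eq_ind_r A Ax uxE)) vy; rewrite -xy uxE ltxx.
by move=> z Az; have [zu|vz] := Auv z Az;
   [left; apply: xmax|right; apply: ymin].
Qed.

Definition fill_gaps d (K : orderTopologicalType d) (F : K -> K -> set K)
    (A : set K) : set K :=
  A `|` [set z | exists u v, gap <=%O A u v /\ F u v z].

Lemma fill_gaps_in_gap d (K : orderTopologicalType d) (F : K -> K -> set K)
    (A : set K) (P : K -> K -> Prop) u v w :
  (forall u v, gap <=%O A u v -> scattered_chain <=%O P u v (F u v)) ->
  gap <=%O A u v -> (u <= w <= v)%O -> fill_gaps F A w -> F u v w.
Proof.
move=> FP Auv /andP[uw wv] GAw; have [_ _ [Fu Fv] _ _] := FP u v Auv.
have [Au Av vu nAuv] := Auv.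
have ends (z : K) : (u <= z <= v)%O -> A z -> z = u \/ z = v.
  move=> /andP[uz zv] /nAuv[zu|vz]; [left|right]; apply/le_anti.
    by rewrite zu uz.
  by rewrite zv vz.
case: GAw => [Aw|[u' [v' [A'uv Fw]]]].
  by have [||->|->] := ends w; rewrite ?uw ?wv.
have [_ _ _ /(_ w Fw) [u'w wv'] _] := FP _ _ A'uv.
have [Au' Av' vu' nAuv'] := A'uv.
have [wu|uw'] := leP w u; first by rewrite (@le_anti _ _ w u) ?Fu // wu uw.
have [vw|wv''] := leP v w; first by rewrite (@le_anti _ _ w v) ?Fv // vw wv.
have u'u : (u' <= u)%O.
  have [//|vu''] := nAuv _ Au'.
  by have := lt_le_trans wv'' (le_trans vu'' u'w); rewrite ltxx.
have vv' : (v <= v')%O.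
  have [v'u|//] := nAuv _ Av'.
  by have := lt_le_trans uw' (le_trans wv' v'u); rewrite ltxx.
have <- : u' = u.
  apply/le_anti; rewrite u'u /=; have [//|v'u] := nAuv' _ Au.
  by have := lt_le_trans uw' (le_trans wv' v'u); rewrite ltxx.
suff <- : v' = v by [].
apply/le_anti; rewrite vv' andbT; have [vu''|//] := nAuv' _ Av.
by have := lt_le_trans wv'' (le_trans vu'' u'w); rewrite ltxx.
Qed.

(** Inside each gap [u < v] of [A] the filled set is just [F u v], and this
interval is open, so both closedness and scatteredness are local there. *)
Lemma scattered_chain_fill_gaps d (K : orderTopologicalType d)
    (F : K -> K -> set K) (A : set K) (P Q : K -> K -> Prop) a b :
  compact [set: K] -> scattered_chain <=%O P a b A ->
  (forall u v, gap <=%O A u v -> scattered_chain <=%O Q u v (F u v)) ->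
  scattered_chain <=%O Q a b (fill_gaps F A).
Proof.
move=> cK [clA sA [Aa Ab] Aab _] FQ; have ole := closed_order_le K.
have cA : compact A by apply: subclosed_compact clA cK _.
have Gab z : fill_gaps F A z -> (a <= z)%O /\ (z <= b)%O.
  move=> [/Aab//|[u [v [Auv Fz]]]].
  have [_ _ _ /(_ z Fz)[uz zv] _] := FQ _ _ Auv; have [Au Av _ _] := Auv.
  have [au _] := Aab _ Au; have [_ vb] := Aab _ Av.
  by split; [apply: le_trans au uz|apply: le_trans zv vb].
have strict u v z : gap <=%O A u v -> ~ A z -> (u <= z)%O -> (z <= v)%O ->
    (u < z < v)%O.
  move=> [Au Av _ _] nAz uz zv; rewrite !lt_neqAle uz zv !andbT.
  by apply/andP; split; apply/eqP => uz'; apply: nAz; rewrite ?uz' // -uz'.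
split.
- move=> z clz; have [Az|nAz] := pselect (A z); first by left.
  have /andP[az zb] : (a <= z <= b)%O.
    apply: (@closed_between _ K a b); apply: closureS clz.
    by move=> w /Gab[aw wb]; rewrite /= aw wb.
  have [||x [y [Axy xz zy]]] := gap_around cA Aa Ab az (lexx z) zb.
    by move=> /nAz.
    by move=> w _; apply/orP; apply: le_total.
  have xzy := strict _ _ _ Axy nAz xz zy.
  right; exists x, y; split=> //; have [clF _ _ _ _] := FQ _ _ Axy.
  apply: clF => W zW; have [|w [Gw [Ww /= /andP[xw wy]]]] :=
    clz (W `&` [set w | (x < w < y)%O]).
    apply: filterI => //; apply: open_nbhs_nbhs; split=> //.
    exact: open_between.
  exists w; split=> //; apply: (fill_gaps_in_gap FQ Axy) => //.
  by rewrite !ltW.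
- apply: (scattered_locally sA) => z [//|[u [v [Auv Fz]]]] nAz.
  have [_ sF _ /(_ z Fz)[uz zv] _] := FQ _ _ Auv.
  exists [set w | (u < w < v)%O].
    by split; [apply: open_between|apply: strict Auv nAz uz zv].
  apply: scatteredS sF => w [Gw /= /andP[uw wv]].
  by apply: (fill_gaps_in_gap FQ Auv) => //; rewrite !ltW.
- by split; left.
- exact: Gab.
- move=> s t [Gs Gt ts Gst].
  have [as_ sb] := Gab _ Gs; have [at_ tb] := Gab _ Gt.
  rewrite -ltNge in ts.
  have [||x [y [Axy xs ty]]] := gap_around cA Aa Ab as_ (ltW ts) tb.
    by [].
    by move=> z Az; apply: Gst; left.
  have [_ _ _ _ FPq] := FQ _ _ Axy.
  have Fsub w : F x y w -> fill_gaps F A w by move=> Fw; right; exists x, y.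
  apply: FPq; split.
  + by apply: (fill_gaps_in_gap FQ Axy) => //;
       rewrite xs (le_trans (ltW ts) ty).
  + by apply: (fill_gaps_in_gap FQ Axy) => //;
       rewrite ty (le_trans xs (ltW ts)).
  + by rewrite -ltNge.
  + by move=> z /Fsub; apply: Gst.
Qed.

Lemma exists_recurrent_sequence :
  exists k : nat -> nat, forall i N, exists2 n, (N <= n)%N & k n = i.
Proof.
(* [logn 2] takes the value [i] at [2 ^ i] times any odd number. *)
exists (fun n => logn 2 n.+1) => i N.
have pos : (0 < 2 ^ i * (2 * N).+1)%N by rewrite muln_gt0 expn_gt0.
exists (2 ^ i * (2 * N).+1).-1.
  rewrite -ltnS prednK //; apply: (@leq_trans (2 * N).+1).
    by rewrite ltnS leq_pmull.
  by rewrite leq_pmull // expn_gt0.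
rewrite prednK // lognM // ?expn_gt0 // pfactorK // logn_coprime ?addn0 //.
by rewrite coprime2n /= oddM.
Qed.

(** * Fragmentable spaces are separated by scattered sets *)

Definition separated_by d (K : orderTopologicalType d) (A : set K) (u v : K) :
    Prop :=
  exists x y, [/\ A x, A y, (u <= x)%O, (x < y)%O & (y <= v)%O].

(** Among the nested intervals [J n] choose [J N] of least rank; then [r (J N)]
contains every [r (J n)].  So [x n] and [y n] lie in the closed set [r (J N)]
for infinitely many [n]; their limits [s] and [t] do too, and
[J N `&` r (J N)] has diameter less than [e]. *)
Lemma nested_gaps_collapse d (K : orderTopologicalType d) (R : realType)
    (dist : K -> K -> R) (e : R) (r : set K -> set K)
    (x y : nat -> K) (s t : K) :
  compact [set: K] -> rank_function dist e r ->
  (forall m n, (m <= n)%N -> (x m <= x n)%O /\ (y n <= y m)%O) ->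
  (forall n, (x n <= s)%O) ->
  (forall u, (forall n, (x n <= u)%O) -> (s <= u)%O) ->
  (forall n, (t <= y n)%O) ->
  (forall u, (forall n, (u <= y n)%O) -> (u <= t)%O) ->
  (s <= t)%O ->
  (forall N, exists2 n, (N <= n)%N &
     r [set z | (x n <= z <= y n)%O] (x n) /\
     r [set z | (x n <= z <= y n)%O] (y n)) ->
  dist s t < e.
Proof.
move=> cK [rP rsub rwf] mon xs sleast ty tgreat st ends.
have ole := closed_order_le K.
pose J n := [set z | (x n <= z <= y n)%O].
have stJ n : J n s /\ J n t.
  by rewrite /J /= xs ty (le_trans st (ty n)) (le_trans (xs n) st).
have clJ n : closed (J n) by apply: closed_between.
have J0 n : J n !=set0 by exists s; case: (stJ n).
have [||_ [N _ <-] rmax] := rwf [set J n | n in [set: nat]].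
- by exists (J 0%N); exists 0%N.
- by move=> _ [n _ <-].
have rJ n : r (J n) `<=` r (J N).
  by apply: rmax; exists n.
have [clr Jr dJ] := rP _ (clJ N) (J0 N).
have cof n : exists m, [/\ (n <= m)%N, r (J N) (x m) & r (J N) (y m)].
  by have [m nm [rx ry]] := ends n; exists m; split=> //; apply: (rJ m).
apply: dJ; split; try by case: (stJ N).
- apply: (@closed_sup K <=%O (range x)) => //.
  + by exists (x 0%N); exists 0%N.
  + by move=> _ [n _ <-]; apply: xs.
  + by move=> u ub; apply: sleast => n; apply: ub; exists n.
  + move=> _ [n _ <-]; have [m [nm rx _]] := cof n; exists (x m).
    by split=> //; case: (mon _ _ nm).
- apply: (@closed_sup K (fun x y => (y <= x)%O) (range y)) => //.
  + exact: closed_order_flip.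
  + by exists (y 0%N); exists 0%N.
  + by move=> _ [n _ <-]; apply: ty.
  + by move=> u ub; apply: tgreat => n; apply: ub; exists n.
  + move=> _ [n _ <-]; have [m [nm _ ry]] := cof n; exists (y m).
    by split=> //; case: (mon _ _ nm).
Qed.

Lemma fragmentable_separated d (K : orderTopologicalType d) (R : realType) :
  compact [set: K] -> fragmentable R K ->
  exists L : nat -> set K,
    (forall n, compact (L n) /\ scattered (L n)) /\
    (forall u v : K, (u < v)%O -> separated_by (\bigcup_n L n) u v).
Proof.
move=> cK [dist [[d0 deq dsym dtri] frd]].
have [[p0 _]|K0] := pselect ([set: K] !=set0); last first.
  exists (fun=> set0); split=> [_|u]; last by exfalso; apply: K0; exists u.
  by split; [exact: compact0|move=> B B0 [z /B0]].
have ole := closed_order_le K.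
have [top _ maxK] := compact_has_max ole cK (ex_intro _ p0 I).
have [bot _ minK] :=
  compact_has_max (closed_order_flip ole) cK (ex_intro _ p0 I).
have {}maxK z : (z <= top)%O by apply: maxK.
have {}minK z : (bot <= z)%O by apply: minK.
have /choice[r rP] : forall k : nat, exists r, rank_function dist k.+1%:R^-1 r.
  by move=> k; apply: fragments_rank_function.
have [k kP] := exists_recurrent_sequence.
have /choice[F FP] : forall p : nat * K * K, exists F, (p.1.2 <= p.2)%O ->
    scattered_chain <=%O (rank_tight (r (k p.1.1))) p.1.2 p.2 F.
  move=> [[n u] v] /=; have [uv|_] := leP u v; last by exists set0.
  by have [F FP] := rank_tight_chain cK (rP (k n)) uv; exists F.
pose L := fix L n := if n is m.+1 then fill_gaps (fun u v => F (m, u, v)) (L m)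
                     else [set bot] `|` [set top].
have FgapP n u v : gap <=%O (L n) u v ->
    scattered_chain <=%O (rank_tight (r (k n))) u v (F (n, u, v)).
  by move=> [_ _ vu _]; apply: (FP (n, u, v)) => /=;
     apply: closed_order_nle ole vu.
have LS n : scattered_chain <=%O
    (fun u v => if n is m.+1 then rank_tight (r (k m)) u v else True)
    bot top (L n).
  elim: n => [|n IHn] /=; last exact: scattered_chain_fill_gaps IHn (FgapP n).
  have cl1 := @order_closed_set1 _ K.
  exact: scattered_chain2.
have Lmon m n : (m <= n)%N -> L m `<=` L n.
  by elim: n => [|n IHn]; rewrite leq_eqVlt => /predU1P[->//|//];
     move=> /IHn mn z /mn; left.
have cL n : compact (L n) by apply: subclosed_compact cK _ => //; case: (LS n).
have Lbt n : L n bot /\ L n top by case: (LS n).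
exists L; split; first by move=> n; split=> //; case: (LS n).
move=> u v uv; apply: contrapT => nsep.
have {}nsep n : ~ separated_by (L n) u v.
  move=> [x [y [Lx Ly ux xy yv]]]; apply: nsep; exists x, y.
  by split=> //; exists n.
(* At most one point of [L] lies in [[u, v]], and cutting there leaves an
   interval whose interior misses every [L n]. *)
have [u' [v' [uu' u'v' v'v Lu'v']]] : exists u' v',
    [/\ (u <= u')%O, (u' < v')%O, (v' <= v)%O
      & forall n z, L n z -> (z <= u')%O \/ (v' <= z)%O].
  have sep m n z w : L m z -> L n w ->
      (u <= z)%O -> (z < w)%O -> (w <= v)%O -> False.
    move=> Lz Lw uz zw wv; apply: (nsep (maxn m n)); exists z, w; split=> //.
      by apply: Lmon Lz; apply: leq_maxl.
    by apply: Lmon Lw; apply: leq_maxr.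
  have [[m [w [Lw uw wv]]]|no] :=
      pselect (exists m w, [/\ L m w, (u <= w)%O & (w <= v)%O]).
    have [uw'|wu] := ltP u w.
      exists u, w; split=> // n z Lz.
      have [|uz] := leP z u; first by left.
      have [|zw] := leP w z; first by right.
      by exfalso; apply: sep Lz Lw (ltW uz) zw wv.
    have uE : u = w by apply/le_anti; rewrite uw wu.
    exists u, v; split=> // n z Lz.
    have [|uz] := leP z u; first by left.
    have [|zw] := leP v z; first by right.
    by exfalso; apply: sep Lw Lz uw _ (ltW zw); rewrite -uE.
  exists u, v; split=> // n z Lz.
  have [|uz] := leP z u; first by left.
  have [|zv] := leP v z; first by right.
  by exfalso; apply: no; exists n, z; rewrite !ltW.
have /choice[J JP] : forall n, exists p : K * K,
    [/\ gap <=%O (L n) p.1 p.2, (p.1 <= u')%O & (v' <= p.2)%O].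
  move=> n; have [Lb Lt] := Lbt n.
  have [//||x [y xyP]] :=
    gap_around (cL n) Lb Lt (minK u') (ltW u'v') (maxK v').
    exact: Lu'v'.
  by exists (x, y).
pose x n := (J n).1; pose y n := (J n).2.
have xuvy n m : (x n < y m)%O.
  by have [_ xu _] := JP n; have [_ _ vy] := JP m;
     apply: le_lt_trans xu (lt_le_trans u'v' vy).
have mon m n : (m <= n)%N -> (x m <= x n)%O /\ (y n <= y m)%O.
  move=> mn; have [[Lx Ly _ _] _ _] := JP m; have [[_ _ _ Ln] _ _] := JP n.
  split.
    have [//|yx] := Ln _ (Lmon _ _ mn _ Lx).
    by have := lt_le_trans (xuvy m n) yx; rewrite ltxx.
  have [yx|//] := Ln _ (Lmon _ _ mn _ Ly).
  by have := lt_le_trans (xuvy n m) yx; rewrite ltxx.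
have [|s xs sleast] := @compact_has_lub K <=%O (range x) ole cK.
  by exists (x 0%N); exists 0%N.
have [|t ty tgreat] :=
  @compact_has_lub K (fun x y => (y <= x)%O) (range y)
    (closed_order_flip ole) cK.
  by exists (y 0%N); exists 0%N.
have su : (s <= u')%O by apply: sleast => _ [n _ <-]; case: (JP n).
have vt : (v' <= t)%O by apply: tgreat => _ [n _ <-]; case: (JP n).
have st : (s < t)%O by apply: le_lt_trans su (lt_le_trans u'v' vt).
(* A gap of [L n] that is a jump of [K] would separate [u] and [v]. *)
have tight n : r (k n) [set z | (x n.+1 <= z <= y n.+1)%O] (x n.+1) /\
               r (k n) [set z | (x n.+1 <= z <= y n.+1)%O] (y n.+1).
  have [Lxy xu vy] := JP n.+1; have [_ _ _ _ FPn] := LS n.+1.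
  have [//|jump] := FPn _ _ Lxy; exfalso; apply: (nsep n.+1).
  have [Lx Ly _ _] := Lxy; exists (x n.+1), (y n.+1); split=> //.
    have [ux|//] := jump u'; last first.
      by move=> yu; have := lt_le_trans u'v' (le_trans vy yu); rewrite ltxx.
    exact: le_trans uu' _.
  have [vx|//] := jump v'.
    by have := lt_le_trans u'v' (le_trans vx xu); rewrite ltxx.
  by move=> yv'; apply: le_trans yv' v'v.
suff : dist s t = 0 by move/deq => stE; rewrite stE ltxx in st.
apply/eqP; rewrite eq_le d0 andbT; apply/ler_addgt0Pl => e e0; rewrite addr0.
have [i ie] : exists i : nat, i.+1%:R^-1 < e.
  by have [i] := ltr_add_invr e0; rewrite add0r; exists i.
apply: ltW; apply: lt_trans ie.
apply: (nested_gaps_collapse cK (rP i) mon) => //.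
- by move=> n; apply: xs; exists n.
- by move=> w wP; apply: sleast => _ [n _ <-].
- by move=> n; apply: ty; exists n.
- by move=> w wP; apply: tgreat => _ [n _ <-].
- exact: ltW.
- move=> N; have [n Nn <-] := kP i N; exists n.+1; first exact: leqW.
  exact: tight.
Qed.

(** * Separation by scattered sets gives a lower semicontinuous metric *)

(** The points of [A] between [x] and [y] include an isolated one, [p]; it
forms a gap with the next point of [A], or with the previous one if
[p = y]. *)
Lemma scattered_gap_between d (K : orderTopologicalType d)
    (A : set K) (x y : K) :
  compact A -> scattered A -> A x -> A y -> (x < y)%O ->
  exists a b, [/\ gap <=%O A a b, (x <= a)%O & (b <= y)%O].
Proof.
move=> cA sA Ax Ay xy; have ole := closed_order_le K.
have ole' := closed_order_flip ole.
have [_ _ _ cl] := ole.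
pose B := A `&` [set z | (x <= z <= y)%O].
have [||p [/set_mem[Ap /andP[xp py]] [W pW WB]]] := sA B; first by move=> z [].
  by exists x; split=> //=; rewrite lexx ltW.
(* Removing an open set around p leaves the compact set of the other points. *)
pose B' := B `&` ~` W°.
have cB' : compact B'.
  apply: (subclosed_compact _ cA) => [|z [[]]//].
  apply: closedI; last by apply: open_closedC; apply: open_interior.
  by apply: closedI; [apply: (compact_closed _ cA); exact: order_hausdorff
                     |exact: closed_between].
have B'E z : B' z <-> [/\ A z, (x <= z <= y)%O & z <> p].
  split=> [[[Az xzy] nWz]|[Az xzy zp]].
    by split=> // zp; apply: nWz; rewrite zp.
  split=> // /interior_subset Wz; apply: zp.
  by have : (W `&` B) z by []; rewrite WB.
have [py'|yp] := ltP p y.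
- have [||q [/B'E[Aq /andP[xq qy] qp] pq] qmin] :=
    @compact_has_max K (fun x y => (y <= x)%O)
      (B' `&` [set z | (p <= z)%O]) ole'.
  + by apply: compact_closedI => //; case: (cl p).
  + exists y; split=> //=; apply/B'E; split=> //.
      by rewrite (ltW xy) lexx.
    by move=> yp; rewrite yp ltxx in py'.
  exists p, q; split=> //; split=> //.
    by rewrite -ltNge lt_neqAle pq andbT; apply/eqP => pq'; apply: qp.
  move=> z Az; have [|pz] := leP z p; first by left.
  right; rewrite leNgt; apply/negP => zq.
  move: (zq); rewrite ltNge => /negP; apply.
  apply: qmin; split; last exact: ltW.
  apply/B'E; split=> //; last by move=> zp; rewrite zp ltxx in pz.
  by rewrite (le_trans xp (ltW pz)) (le_trans (ltW zq) qy).
- have {yp} py' : p = y by apply/le_anti; rewrite py yp.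
  have [//||q /B'E[Aq /andP[xq qy] qp] qmax] :=
    @compact_has_max K <=%O B' ole.
  + exists x; apply/B'E; split=> //; first by rewrite lexx (ltW xy).
    by move=> xp'; rewrite xp' py' ltxx in xy.
  exists q, p; split=> //; split=> //.
    rewrite -ltNge lt_neqAle py' qy andbT.
    by apply/eqP => qp'; apply: qp; rewrite py'.
  move=> z Az; have [|pz] := leP p z; first by right.
  left; rewrite leNgt; apply/negP => qz.
  move: (qz); rewrite ltNge => /negP; apply.
  apply: qmax.
  apply/B'E; split=> //; last by move=> zp; rewrite zp ltxx in pz.
  by rewrite (le_trans xq (ltW qz)) (le_trans (ltW pz) py).
Qed.

Lemma gap_separating_function d (K : orderTopologicalType d) (R : realType)
    (a b : K) :
  compact [set: K] -> (a < b)%O -> exists f : K -> R,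
    [/\ continuous f, forall z, 0 <= f z <= 1,
        forall z, (z <= a)%O -> f z = 0 & forall z, (b <= z)%O -> f z = 1].
Proof.
move=> cK ab.
have nK : normal_space K := compact_normal order_hausdorff cK.
have [||||f [cf f0 f1 f01]] :=
  @urysohn_ext_itv K R nK `]-oo, a]%classic `[b, +oo[%classic 0 1.
- exact: lray_closed.
- exact: rray_closed.
- rewrite -subset0 => z /=; rewrite !in_itv /= andbT => -[za bz].
  by have := lt_le_trans ab (le_trans bz za); rewrite ltxx.
- exact: ltr01.
exists f; split=> // z.
- by have := f01 (f z); rewrite /= in_itv /=; apply; exists z.
- by move=> za; apply: f0; exists z => //=; rewrite in_itv.
- by move=> bz; apply: f1; exists z => //=; rewrite in_itv /= andbT.
Qed.

(** If [M] lies in [A], isolate one of its points.  Otherwise a point of [M] is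
in an open gap of [A], where all the functions of the other gaps are constant
and [f a b] is continuous. *)
Lemma gap_functions_fragment d (K : orderTopologicalType d) (R : realType)
    (f : K -> K -> K -> R) (A M : set K) (bot top : K) (e : R) :
  (forall a b, (a < b)%O ->
     [/\ continuous (f a b), forall z, 0 <= f a b z <= 1,
         forall z, (z <= a)%O -> f a b z = 0 &
         forall z, (b <= z)%O -> f a b z = 1]) ->
  compact A -> scattered A -> A bot -> A top ->
  (forall z, (bot <= z <= top)%O) -> 0 < e -> M !=set0 ->
  exists U : set K, [/\ open U, M `&` U !=set0 &
    forall u v a b, (M `&` U) u -> (M `&` U) v -> gap <=%O A a b ->
      `|f a b u - f a b v| < e].
Proof.
move=> fP cA sA Ab At bt e0 M0.
have [MA|] := pselect (M `<=` A).
  have [p [/set_mem Mp [W pW WM]]] := sA M MA M0.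
  exists W°; split; [exact: open_interior|by exists p|].
  move=> u v a b [Mu /interior_subset Wu] [Mv /interior_subset Wv] _.
  have -> : u = p by have : (W `&` M) u by []; rewrite WM.
  have -> : v = p by have : (W `&` M) v by []; rewrite WM.
  by rewrite subrr normr0.
move=> /existsNP[p /not_implyP[Mp nAp]].
have /andP[bp pt] := bt p.
have [||a [b [Aab ap pb]]] := gap_around cA Ab At bp (lexx p) pt.
- by move=> /nAp.
- by move=> w _; apply/orP; apply: le_total.
have [Aa Aabb ba nAab] := Aab.
have ab : (a < b)%O by rewrite ltNge.
have {}ap : (a < p)%O.
  by rewrite lt_neqAle ap andbT; apply/eqP => ap'; apply: nAp; rewrite -ap'.
have {}pb : (p < b)%O.
  by rewrite lt_neqAle pb andbT; apply/eqP => pb'; apply: nAp; rewrite pb'.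
have [fc _ _ _] := fP a b ab.
pose W := [set z | `|f a b p - f a b z| < e / 2].
have pW : nbhs p W.
  by apply: (cvgr_dist_lt _ (f a b p) (fc p)); rewrite divr_gt0.
exists ([set z | (a < z < b)%O] `&` W°); split.
- by apply: openI; [exact: open_between|exact: open_interior].
- by exists p; split=> //; split=> //=; rewrite ap pb.
move=> u v a' b' [_ [/= /andP[au ub] /interior_subset Wu]]
  [_ [/= /andP[av vb] /interior_subset Wv]] [Aa' Ab' ba' nAab'].
have ab' : (a' < b')%O by rewrite ltNge.
have [_ _ f0 f1] := fP a' b' ab'.
have [aa'|b'a] := nAab' a Aa; last first.
  by rewrite !f1 ?subrr ?normr0 //; apply: le_trans b'a _; apply: ltW.
have [ba''|b'b] := nAab' b Aabb.
  by rewrite !f0 ?subrr ?normr0 //; apply: le_trans ba''; apply: ltW.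
have a'E : a' = a.
  apply/le_anti; rewrite aa' andbT; have [//|ba''] := nAab a' Aa'.
  by have := lt_le_trans ab' (le_trans b'b ba''); rewrite ltxx.
have b'E : b' = b.
  apply/le_anti; rewrite b'b /=; have [b'a|//] := nAab b' Ab'.
  by have := lt_le_trans ab' (le_trans b'a aa'); rewrite ltxx.
rewrite a'E b'E.
have -> : f a b u - f a b v = (f a b p - f a b v) - (f a b p - f a b u).
  by rewrite opprB [RHS]addrC subrKA.
apply: (le_lt_trans (ler_normB _ _)).
by rewrite (splitr e) ltrD.
Qed.

Lemma separated_radon_nikodym d (K : orderTopologicalType d) (R : realType)
    (L : nat -> set K) :
  compact [set: K] -> (forall n, compact (L n) /\ scattered (L n)) ->
  (forall u v : K, (u < v)%O -> separated_by (\bigcup_n L n) u v) ->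
  radon_nikodym R K.
Proof.
move=> cK LP Lsep; have ole := closed_order_le K.
have [[p0 _]|K0] := pselect ([set: K] !=set0); last first.
  have noK (x : K) : False by apply: K0; exists x.
  exists (fun _ _ => 0); split; last by case=> x; case: (noK x).
    by split=> x; case: (noK x).
  by move=> M e [x]; case: (noK x).
have [top _ maxK] := compact_has_max ole cK (ex_intro _ p0 I).
have [bot _ minK] :=
  compact_has_max (closed_order_flip ole) cK (ex_intro _ p0 I).
have bt (z : K) : (bot <= z <= top)%O by rewrite maxK ?minK.
(* Adding the end points of [K] puts every other point in a gap. *)
pose A := fix A n := if n is m.+1 then A m `|` L m else [set bot] `|` [set top].
have AP n : compact (A n) /\ scattered (A n).
  have clC (C : set K) : compact C -> closed C.
    by apply: compact_closed; exact: order_hausdorff.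
  elim: n => [|n [cA sA]] /=; last first.
    have [cL sL] := LP n; split; first exact: compactU.
    by apply: scatteredU sL => //; apply: clC.
  split; first by apply: compactU; apply: compact_set1.
  by apply: scatteredU; [|exact: scattered_set1..];
     apply: clC; apply: compact_set1.
have Amon m n : (m <= n)%N -> A m `<=` A n.
  by elim: n => [|n IHn]; rewrite leq_eqVlt => /predU1P[->//|//];
     move=> /IHn mn z /mn; left.
have Abt n : A n bot /\ A n top.
  by split; apply: (Amon 0%N n (leq0n n)); [left|right].
have /choice[g gP] : forall p : K * K, exists f : K -> R, (p.1 < p.2)%O ->
    [/\ continuous f, forall z, 0 <= f z <= 1,
        forall z, (z <= p.1)%O -> f z = 0 & forall z, (p.2 <= z)%O -> f z = 1].
  move=> [a b] /=; have [ab|_] := ltP a b; last by exists (fun=> 0).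
  by have [f fP] := gap_separating_function R cK ab; exists f.
pose f a b := g (a, b).
have {gP} fP a b : (a < b)%O ->
    [/\ continuous (f a b), forall z, 0 <= f a b z <= 1,
        forall z, (z <= a)%O -> f a b z = 0 &
        forall z, (b <= z)%O -> f a b z = 1].

  exact: (gP (a, b)).
have gaplt n a b : gap <=%O (A n) a b -> (a < b)%O by case; rewrite ltNge.
have f1 a b u v : (a < b)%O -> `|f a b u - f a b v| <= 1.
  move=> /fP[_ f01 _ _]; have /andP[u0 u1] := f01 u; have /andP[v0 v1] := f01 v.
  by rewrite ler_norml; apply/andP; split; lra.
pose W u v := [set w : R | w = 0 \/
  exists n a b, gap <=%O (A n) a b /\ w = n.+1%:R^-1 * `|f a b u - f a b v|].
pose dist u v := sup (W u v).
have W0 u v : W u v !=set0 by exists 0; left.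
have Wub u v : has_ubound (W u v).
  exists 1 => w [->|[n [a [b [/gaplt ab ->]]]]]; first exact: ler01.
  apply: mulr_ile1; [by rewrite invr_ge0|exact: normr_ge0| |exact: f1].
  by rewrite invf_le1 ?ltr0n // ler1n.
have le_dist u v w : W u v w -> w <= dist u v by move=> Ww; apply: ub_le_sup.
have dist_le u v x : (forall w, W u v w -> w <= x) -> dist u v <= x.
  by move=> wx; apply: ge_sup.
have dist_ge0 u v : 0 <= dist u v by apply: le_dist; left.
have distC u v : dist u v = dist v u.
  rewrite /dist; congr sup; apply/seteqP; split=> w;
    move=> [->|[n [a [b [Aab ->]]]]];
    by [left|right; exists n, a, b; rewrite distrC].
have dist_lt u v : (u < v)%O -> 0 < dist u v.
  move=> /Lsep[x [y [[m _ Lx] [n _ Ly] ux xy yv]]].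
  have [cA sA] := AP (maxn m n).+1.
  have Ax : A (maxn m n).+1 x.
    by apply: (Amon m.+1); [rewrite ltnS leq_maxl|right].
  have Ay : A (maxn m n).+1 y.
    by apply: (Amon n.+1); [rewrite ltnS leq_maxr|right].
  have [a [b [Aab xa by_]]] := scattered_gap_between cA sA Ax Ay xy.
  apply: (@lt_le_trans _ _ (maxn m n).+2%:R^-1); first by rewrite invr_gt0.
  apply: le_dist; right; exists (maxn m n).+1, a, b; split=> //.
  have [_ _ f0 f1'] := fP _ _ (gaplt _ _ _ Aab).
  rewrite f0 ?f1' ?sub0r ?normrN ?normr1 ?mulr1 //.
    exact: le_trans by_ yv.
  exact: le_trans ux xa.
exists dist; split.
- split=> //.
  + move=> u v; split=> [duv|->].
      apply/eqP/negPn/negP; rewrite neq_lt => /orP[/dist_lt|/dist_lt].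
        by rewrite duv ltxx.
      by rewrite distC duv ltxx.
    apply/eqP; rewrite eq_le dist_ge0 andbT; apply: dist_le => w [->//|].
    by move=> [n [a [b [_ ->]]]]; rewrite subrr normr0 mulr0.
  + move=> u v z; apply: dist_le => w [->|[n [a [b [Aab ->]]]]].
      by apply: addr_ge0.
    apply: (@le_trans _ _ (n.+1%:R^-1 * `|f a b u - f a b v| +
                           n.+1%:R^-1 * `|f a b v - f a b z|)).
      by rewrite -mulrDr ler_wpM2l ?invr_ge0 // ler_distD.
    by apply: lerD; apply: le_dist; right; exists n, a, b.
(* The terms with [n >= N] are small because of their weights; the finitely many
   others are made small one after the other. *)
- move=> M e M0 e0.
  have e20 : 0 < e / 2 by rewrite divr_gt0.
  have [N Ne] : exists N : nat, N.+1%:R^-1 < e / 2.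
    by have [i] := ltr_add_invr e20; rewrite add0r; exists i.
  have [U [oU MU fU]] : exists U : set K, [/\ open U, M `&` U !=set0 &
      forall u v n a b, (M `&` U) u -> (M `&` U) v -> (n < N)%N ->
        gap <=%O (A n) a b -> `|f a b u - f a b v| < e / 2].
    elim: N {Ne} => [|N [U [oU MU fU]]].
      by exists setT; split=> //; [exact: openT|rewrite setIT].
    have [cA sA] := AP N; have [Ab At] := Abt N.
    have [V [oV MV fV]] := gap_functions_fragment fP cA sA Ab At bt e20 MU.
    exists (U `&` V); split; [exact: openI|by rewrite setIA|].
    move=> u v n a b; rewrite setIA => Mu Mv.
    rewrite ltnS leq_eqVlt => /predU1P[->|nN] Aab; first exact: fV.
    by apply: fU nN Aab; [case: Mu|case: Mv].
  exists U; split=> //.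
  apply: (@le_lt_trans _ _ (e / 2)%:E); last first.
    by rewrite lte_fin gtr_pMr // invf_lt1 // ltr1n.
  apply: ge_ereal_sup => _ [u Mu [v Mv <-]]; rewrite lee_fin.
  apply: dist_le => w [->|[n [a [b [Aab ->]]]]]; first exact: ltW e20.
  have [nN|Nn] := ltnP n N.
    apply: le_trans (ltW (fU _ _ _ _ _ Mu Mv nN Aab)).
    by rewrite ler_piMl // invf_le1 ?ltr0n // ler1n.
  apply: le_trans (ltW Ne); apply: (@le_trans _ _ n.+1%:R^-1).
    by rewrite ler_piMr ?invr_ge0 // f1 // (gaplt _ _ _ Aab).
  by rewrite lef_pV2 ?posrE ?ltr0n // ler_nat.
- move=> [u v] x /=; rewrite lte_fin.
  move=> /sup_gt[//|w [->|[n [a [b [Aab ->]]]]] xw].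
    exists setT; first exact: filterT.
    by move=> y _; rewrite lte_fin; apply: lt_le_trans (dist_ge0 _ _).
  have [fc _ _ _] := fP _ _ (gaplt _ _ _ Aab).
  pose h (p : K * K) := n.+1%:R^-1 * `|f a b p.1 - f a b p.2|.
  have hc : h p @[p --> (u, v)] --> h (u, v).
    apply: cvgMl_tmp; apply: cvg_norm; apply: cvgB.
      apply: (@continuous_comp _ _ _ fst (f a b)); last exact: fc.
      exact: cvg_fst.
    apply: (@continuous_comp _ _ _ snd (f a b)); last exact: fc.
    exact: cvg_snd.
  exists [set p | x < h p]; first exact: (cvgr_gt _ hc).
  move=> y xh; rewrite lte_fin; apply: (lt_le_trans xh); apply: le_dist.
  by right; exists n, a, b.
Qed.

(** * The equivalence *)

Theorem theorem1p3 (R : realType) (disp : Order.disp_t)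
    (K : orderTopologicalType disp) (K_compact : compact [set: K]) :
  [<-> fragmentable R K;
       exists L : nat -> set K,
         (forall n : nat, compact (L n) /\ scattered (L n)) /\
         (forall u v : K, (u < v)%O ->
            exists x y : K,
              [/\ (\bigcup_n L n) x, (\bigcup_n L n) y,
                  (u <= x)%O, (x < y)%O & (y <= v)%O]);
       radon_nikodym R K].
Proof.
tfae.
- exact: fragmentable_separated.
- by move=> [L [LP Lsep]]; apply: separated_radon_nikodym LP Lsep.
- by move=> [d [dm df _]]; exists d.
Qed.
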